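(* Every (finite) submodular data set $D$, with universe $\vec U$ of oriented separations of $D$, has a canonical regular tree set $T\subseteq U$ of separations which efficiently distinguishes all its distinguishable clusters; that is, every two distinguishable clusters of $D$ are efficiently distinguished by some separation in $T$.
   Context: A separation of a set $D$ is a set $\{A,B\}$ of subsets of $D$ with $A\cup B=D$ (a side may be empty); its orientations are $(A,B)$ and $(B,A)$. Oriented separations are ordered by $(A,B)\le(C,D')$ iff $A\subseteq C$ and $B\supseteq D'$; put $(A,B)^*=(B,A)$, $(A,B)\vee(C,D')=(A\cup C,B\cap D')$ and $(A,B)\wedge(C,D')=(A\cap C,B\cup D')$. A submodular data set is a set $D$ with at least two elements together with a set $U$ of separations of $D$ whose set $\vec U$ of orientations is closed under $\vee$ and $\wedge$, and a submodular order function: a real function $\vec s\mapsto|\vec s|$ on $\vec U$ with $0\le|\vec s|=|\vec s^{\,*}|$ and $|\vec r\vee\vec s|+|\vec r\wedge\vec s|\le|\vec r|+|\vec s|$ for all $\vec r,\vec s\in\vec U$. The order of $s=\{\vec s,\vec s^{\,*}\}$ is $|s|=|\vec s|$. For an integer $k>0$ let $\vec S_k=\{\vec s\in\vec U:|\vec s|<k\}$, and let $S_k$ be the corresponding set of unoriented separations. $\vec s$ is small if $\vec s\le\vec s^{\,*}$, and degenerate if $\vec s=\vec s^{\,*}$. An orientation of $S_k$ is a set $O\subseteq\vec S_k$ containing exactly one orientation of every non-degenerate $s\in S_k$, and containing every degenerate element of $\vec S_k$. It is consistent if there are no distinct $r,s\in S_k$ with orientations $\vec r<\vec s$ such that $\vec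 r^{\,*},\vec s\in O$. A $k$-profile in $\vec U$ is a consistent orientation $P$ of $S_k$ such that $(\vec r\vee\vec s)^*\notin P$ for all $\vec r,\vec s\in P$. A profile in $\vec U$ is a $k$-profile in $\vec U$ for some integer $k>0$. It is regular if it contains no separation whose inverse is small. It is robust if for every $\vec r\in P$ and every $s\in U$ with orientations $\vec s,\vec s^{\,*}$: if $\vec r^{\,*}\wedge\vec s$ and $\vec r^{\,*}\wedge\vec s^{\,*}$ both have order $<|\vec r|$, they do not both lie in $P$. The clusters of $D$ are the robust and regular profiles in $\vec U$. A non-degenerate $s\in U$ distinguishes profiles $P,P'$ if it has an orientation $\vec s\in P$ with $\vec s^{\,*}\in P'$. Profiles are distinguishable if some $s\in U$ distinguishes them; $s$ distinguishes them efficiently if $|s|$ is smallest among the orders of all separations in $U$ distinguishing them. For $T\subseteq U$ let $\vec T$ be the set of orientations of its elements. $T$ is nested if every two of its elements have comparable orientations. An element $\vec r\in\vec T$ is trivial in $\vec T$ if there is $s\in T$ with $\vec r<\vec s$ and $\vec r<\vec s^{\,*}$. $T$ is a tree set if it is nested and $\vec T$ has no trivial or degenerate elements; it is regular if no element of $\vec T$ is small. An isomorphism between submodular universes is a bijection respecting their orderings and commuting with the involutions $^*$ and the order functions. $T$ canonical means that the map $\vec U\mapsto T$ can be chosen so as to commute with isomorphisms of such universes; in particular, $T$ is invariant under the automorphisms of $\vec U$. *)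

(* Defs.v *)
From mathcomp Require Import all_boot all_order all_algebra.
From mathcomp Require Import reals.

Set Implicit Arguments.
Unset Strict Implicit.
Unset Printing Implicit Defensive.

Import Order.TTheory GRing.Theory Num.Theory.
Local Open Scope ring_scope.

(* A separation {A, B} is the set of its two sides; since A and B cover the
   ground set, {A, B} is a singleton only if A = B is the whole ground set. *)
Notation sep D := {set {set D}}.
Notation osep D := ({set D} * {set D})%type.

Section Separations.
Variable D : finType.
Implicit Types (r s : osep D) (T : {set sep D}).

Definition is_separation (s : sep D) : bool :=
  [exists A : {set D}, exists B : {set D},
    (s == [set A; B]) && (A :|: B == [set: D])].

Definition unorient s : sep D := [set s.1; s.2].
Definition orientations T : {set osep D} := [set s | unorient s \in T].

Definition sinv s : osep D := (s.2, s.1).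
Definition sle r s : bool := (r.1 \subset s.1) && (s.2 \subset r.2).
Definition slt r s : bool := (r != s) && sle r s.
Definition sjoin r s : osep D := (r.1 :|: s.1, r.2 :&: s.2).
Definition smeet r s : osep D := (r.1 :&: s.1, r.2 :|: s.2).

Definition small s : bool := sle s (sinv s).
Definition degenerate s : bool := s == sinv s.

Definition nested T : Prop :=
  forall s t : sep D, s \in T -> t \in T ->
  exists s' t' : osep D,
    [/\ unorient s' = s, unorient t' = t & sle s' t' \/ sle t' s'].

Definition trivial_in T r : Prop :=
  exists s, [/\ s \in orientations T, slt r s & slt r (sinv s)].

Definition tree_set T : Prop :=
  nested T /\
  forall r, r \in orientations T -> ~ trivial_in T r /\ ~~ degenerate r.

Definition regular_seps T : Prop :=
  forall r, r \in orientations T -> ~~ small r.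

End Separations.

(* Only the values of [ord] on the orientations of the members of [seps] are
   meaningful; its other values are never used. *)
Record submodular_data (R : realType) := SubmodularData {
  ground :> finType;
  seps : {set sep ground};
  ord : osep ground -> R;
  ground_ge2 : (2 <= #|ground|)%N;
  sepsP : {in seps, forall s, is_separation s};
  sepsU : {in orientations seps &, forall r s, sjoin r s \in orientations seps};
  sepsI : {in orientations seps &, forall r s, smeet r s \in orientations seps};
  ord_ge0 : {in orientations seps, forall s, 0 <= ord s};
  ord_inv : {in orientations seps, forall s, ord (sinv s) = ord s};
  ord_submod : {in orientations seps &, forall r s,
    ord (sjoin r s) + ord (smeet r s) <= ord r + ord s}
}.

Section Clusters.
Variables (R : realType) (S : submodular_data R).
Implicit Types (r : osep S) (O P : {set osep S}) (k : nat).

Definition universe : {set osep S} := orientations (seps S).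

Definition oS k : {set osep S} := [set s in universe | ord s < k%:R].

(* The exclusive or expresses that exactly one orientation lies in [O]. *)
Definition orientation_of k O : Prop :=
  O \subset oS k /\
  forall r, r \in oS k ->
    if degenerate r then r \in O else (r \in O) (+) (sinv r \in O).

Definition consistent k O : Prop :=
  ~ exists r s : osep S,
      [/\ r \in oS k, s \in oS k & unorient r != unorient s] /\
      [/\ slt r s, sinv r \in O & s \in O].

Definition k_profile k P : Prop :=
  [/\ orientation_of k P, consistent k P &
      forall r s : osep S, r \in P -> s \in P -> sinv (sjoin r s) \notin P].

Definition profile P : Prop := exists2 k, (0 < k)%N & k_profile k P.

Definition regular_profile P : Prop :=
  forall r, r \in P -> ~~ small (sinv r).

Definition robust P : Prop :=
  forall r s : osep S, r \in P -> s \in universe ->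
    ord (smeet (sinv r) s) < ord r ->
    ord (smeet (sinv r) (sinv s)) < ord r ->
    ~ (smeet (sinv r) s \in P /\ smeet (sinv r) (sinv s) \in P).

Definition cluster P : Prop := [/\ profile P, robust P & regular_profile P].

Definition distinguishes (s : sep S) P P' : Prop :=
  s \in seps S /\
  exists r, [/\ unorient r = s, ~~ degenerate r, r \in P & sinv r \in P'].

Definition distinguishable P P' : Prop := exists s, distinguishes s P P'.

(* Both orientations of a separation in [seps S] have the same order, which is
   the order of that separation. *)
Definition efficiently_distinguishes (s : sep S) P P' : Prop :=
  distinguishes s P P' /\
  forall t : sep S, distinguishes t P P' ->
  forall s' t' : osep S, unorient s' = s -> unorient t' = t ->
    ord s' <= ord t'.

Definition efficiently_distinguishes_clusters (T : {set sep S}) : Prop :=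
  forall P P', cluster P -> cluster P' -> distinguishable P P' ->
  exists2 s, s \in T & efficiently_distinguishes s P P'.

End Clusters.

(* An isomorphism of universes need not come from a map between the ground
   sets.  It is given by any extension to all pairs of sets. *)
Definition universe_iso (R : realType) (S S' : submodular_data R)
    (f : osep S -> osep S') : Prop :=
  [/\ {in universe S &, injective f},
      f @: universe S = universe S',
      {in universe S &, forall r s, sle (f r) (f s) = sle r s},
      {in universe S, forall s, f (sinv s) = sinv (f s)} &
      {in universe S, forall s, ord (f s) = ord s}].

Definition canonical (R : realType)
    (T : forall S : submodular_data R, {set sep S}) : Prop :=
  forall (S S' : submodular_data R) (f : osep S -> osep S'),
    universe_iso f -> orientations (T S') = f @: orientations (T S).

(* Main.v *)
From mathcomp Require Import boolp.
Require Import Defs.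
From mathcomp Require Import all_boot all_order all_algebra.
From mathcomp Require Import reals.

(** The tree set is built level by level, in increasing order of its
    separations. Every pair of distinguishable clusters has a set of efficient
    distinguishers, all of the same order. When the level of that order is
    reached, the pair selects, among its efficient distinguishers that are
    nested with everything selected at lower levels, all those that cross the
    fewest separations of the universe. No choice is made between equally good
    candidates, so the construction commutes with isomorphisms.

    Everything rests on two facts about crossing separations [r] and [s].
    Each of their four corners is nested with [r], with [s], and with whatever
    is nested with both ([nest_join]); and two opposite corners together cross
    strictly fewer separations than [r] and [s] do
    ([crossing_number_corners]).

    If [r] has smaller order than [s], submodularity and robustness provide
    a corner that distinguishes efficiently the same clusters as [s]
    ([uncross_lower]). Replacing [s] by it repeatedly makes [s] nested with all
    lower levels, so that every pair has something to select
    ([eligible_exists]).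

    If [r] and [s] have the same order, submodularity turns two opposite
    corners into efficient distinguishers for the pairs distinguished by [r]
    and [s] ([uncross_same_order]). As these corners cross less in total, [r]
    and [s] cannot both have been selected, so the selected separations are
    nested ([chosen_nest]).

    Regularity of the tree set is inherited from the clusters: both
    orientations of a selected separation lie in some cluster, so neither is
    small. Since trivial and degenerate separations are small, the nested set
    is a tree set. *)

Set Implicit Arguments.
Unset Strict Implicit.
Unset Printing Implicit Defensive.

Import Order.TTheory GRing.Theory Num.Theory.
Local Open Scope ring_scope.

(** * Nested and crossing separations *)

Section OrientedSeparations.
Variable D : finType.
Implicit Types r s t x : osep D.

Lemma sinvK : involutive (@sinv D). Proof. by case. Qed.

Lemma sle_refl r : sle r r. Proof. by rewrite /sle !subxx. Qed.

Lemma sle_trans s r t : sle r s -> sle s t -> sle r t.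
Proof.
move=> /andP[r1 r2] /andP[s1 s2].
by rewrite /sle (subset_trans r1 s1) (subset_trans s2 r2).
Qed.

Lemma sle_anti r s : sle r s -> sle s r -> r = s.
Proof.
case: r s => [a b] [c d] /andP[/= ac db] /andP[/= ca bd].
by congr pair; apply/eqP; rewrite eqEsubset ?ac ?ca ?bd ?db.
Qed.

Lemma sle_inv r s : sle (sinv r) (sinv s) = sle s r.
Proof. by rewrite /sle andbC. Qed.

Lemma sle_invl r s : sle (sinv r) s = sle (sinv s) r.
Proof. by rewrite -sle_inv sinvK. Qed.

Lemma sle_invr r s : sle r (sinv s) = sle s (sinv r).
Proof. by rewrite -sle_inv sinvK. Qed.

Lemma sjoinC r s : sjoin r s = sjoin s r.
Proof. by rewrite /sjoin setUC setIC. Qed.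

Lemma smeetC r s : smeet r s = smeet s r.
Proof. by rewrite /smeet setUC setIC. Qed.

Lemma sle_joinl r s : sle r (sjoin r s).
Proof. by rewrite /sle subsetUl subsetIl. Qed.

Lemma sle_joinr r s : sle s (sjoin r s).
Proof. by rewrite sjoinC sle_joinl. Qed.

Lemma sle_meetl r s : sle (smeet r s) r.
Proof. by rewrite /sle subsetIl subsetUl. Qed.

Lemma sle_meetr r s : sle (smeet r s) s.
Proof. by rewrite smeetC sle_meetl. Qed.

Lemma sjoin_le r s t : sle r t -> sle s t -> sle (sjoin r s) t.
Proof.
move=> /andP[r1 r2] /andP[s1 s2].
by rewrite /sle subUset subsetI r1 r2 s1 s2.
Qed.

Lemma unorient_sinv r : unorient (sinv r) = unorient r.
Proof. by rewrite /unorient setUC. Qed.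

Lemma unorient_eq r s : unorient r = unorient s -> r = s \/ r = sinv s.
Proof.
case: r s => [a b] [c d] /setP; rewrite /unorient /sinv /= => e.
move: (esym (e a)) (esym (e b)) (e c) (e d); rewrite !inE !eqxx ?orbT /=.
case/orP=> /eqP-> /orP[] /eqP->; rewrite ?orbb.
- by move=> _ /eqP->; left.
- by left.
- by right.
- by move=> /eqP->; left.
Qed.

Definition nest r s : bool :=
  [|| sle r s, sle r (sinv s), sle (sinv r) s | sle (sinv r) (sinv s)].

Lemma nest_sinvl r s : nest (sinv r) s = nest r s.
Proof. by rewrite /nest sinvK; do ![case: (sle _ _)]. Qed.

Lemma nestC r s : nest r s = nest s r.
Proof.
rewrite /nest !sle_inv (sle_invr r s) (sle_invl r s).
by do ![case: (sle _ _)].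
Qed.

Lemma nest_sinvr r s : nest r (sinv s) = nest r s.
Proof. by rewrite nestC nest_sinvl nestC. Qed.

Lemma nest_refl r : nest r r. Proof. by rewrite /nest sle_refl. Qed.

Lemma nest_join_self r s : nest (sjoin r s) r.
Proof. by rewrite nestC /nest sle_joinl. Qed.

Lemma nestP r t :
  reflect ((sle t r \/ sle (sinv t) r) \/ (sle r t \/ sle r (sinv t)))
          (nest r t).
Proof.
rewrite /nest sle_inv (sle_invl r t).
apply: (iffP or4P) => [[] h|[[] h|[] h]]; [tauto.. | | | |].
- exact: Or44.
- exact: Or43.
- exact: Or41.
- exact: Or42.
Qed.

(** The only way in which [t] can be nested with both [r] and [s] without
    being nested with their join is that it separates [r] from [s], but then
    [r] and [s] are themselves nested. *)
Lemma nest_join r s t :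
  ~~ nest r s -> nest r t -> nest s t -> nest (sjoin r s) t.
Proof.
move=> crs /nestP nr /nestP ns; apply/nestP.
have up x : sle x r \/ sle x s -> sle x (sjoin r s).
  by case=> /sle_trans; apply; rewrite ?sle_joinl ?sle_joinr.
case: nr => [[] h|nr]; try by left; auto.
case: ns => [[] h|ns]; try by left; auto.
case: nr ns => h [] k; try by right; auto using sjoin_le.
- case/nestP: crs; right; right; rewrite sle_invr in k.
  exact: sle_trans h k.
- case/nestP: crs; right; right; apply: sle_trans h _.
  by rewrite sle_inv.
Qed.

Lemma nest_meet r s t :
  ~~ nest r s -> nest r t -> nest s t -> nest (smeet r s) t.
Proof.
move=> crs nr ns; rewrite -nest_sinvl.
by apply: (@nest_join (sinv r) (sinv s)); rewrite ?nest_sinvl ?nest_sinvr.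
Qed.

Lemma nest_join_or_meet r s t :
  nest r t -> nest (sjoin r s) t || nest (smeet r s) t.
Proof.
case/nestP=> h; apply/orP; [left | right]; apply/nestP.
- by left; case: h => /sle_trans h; [left | right]; apply: h; apply: sle_joinl.
- by right; case: h => h; [left | right]; apply: sle_trans (sle_meetl r s) h.
Qed.

End OrientedSeparations.

(** * Clusters *)

Section Construction.
Variables (R : realType) (S : submodular_data R).
Implicit Types (r s t u x y z : osep S) (P Q N : {set osep S}).
Local Notation U := (universe S).

Lemma universe_sinv r : (sinv r \in U) = (r \in U).
Proof. by rewrite !inE unorient_sinv. Qed.

Lemma cluster_universe P : cluster P -> {subset P <= U}.
Proof.
by case=> [[k _ [[sub _] _ _]] _ _] r /(subsetP sub); rewrite inE => /andP[].
Qed.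

Lemma cluster_not_small P r : cluster P -> r \in P -> ~~ small (sinv r).
Proof. by case=> _ _; apply. Qed.

(** The element [y] of [P] stands for the bound [k] of the profile, which this
    formulation avoids naming: everything of order at most that of [y] is
    oriented by [P]. *)
Lemma cluster_orients P x y :
  cluster P -> y \in P -> x \in U -> ord x <= ord y ->
  x \in P \/ sinv x \in P.
Proof.
case=> [[k _ [[sub or] _ _]] _ _] /(subsetP sub).
rewrite inE => /andP[_ yk] xU xy.
have /or : x \in oS S k by rewrite inE xU (le_lt_trans xy yk).
case: ifP => _; first by left.
by case: (x \in P); [left | right].
Qed.

(** Consistency alone says nothing about the two orientations of a single
    separation; for these regularity excludes that [sinv z] lies below
    [z]. *)
Lemma cluster_down P x y z :
  cluster P -> y \in P -> z \in P -> x \in U -> ord x <= ord y ->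
  sle x z -> x \in P.
Proof.
move=> cP yP zP xU xy xz; case: (cluster_orients cP yP xU xy) => // ixP.
case: (eqVneq (unorient x) (unorient z)) => [/unorient_eq[->//|ex]|ne].
  by have := cluster_not_small cP zP; rewrite /small sinvK -ex xz.
case: (cP) => [[k _ [[sub _] con _]] _ _].
have := subsetP sub _ yP; rewrite inE => /andP[_ yk].
case: con; exists x, z; split; split=> //.
- by rewrite inE xU (le_lt_trans xy yk).
- exact: subsetP sub _ zP.
- by rewrite /slt xz andbT; apply: contraNneq ne => ->.
Qed.

Lemma cluster_join P x y z :
  cluster P -> x \in P -> y \in P -> z \in P ->
  ord (sjoin x y) <= ord z -> sjoin x y \in P.
Proof.
move=> cP xP yP zP le.
have jU : sjoin x y \in U by apply: sepsU; apply: cluster_universe cP _ _.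
case: (cluster_orients cP zP jU le) => // h.
case: (cP) => [[k _ [_ _ pr]] _ _].
by have := pr _ _ xP yP; rewrite h.
Qed.

(** Such an [r] is automatically non-degenerate, because a degenerate
    separation is small and equal to its own inverse, which keeps it out of
    regular profiles. *)
Definition efficient r P P' : Prop :=
  [/\ r \in P, sinv r \in P' &
      forall t, t \in P -> sinv t \in P' -> ord r <= ord t].

Lemma efficient_sinv r P P' :
  cluster P -> cluster P' -> efficient r P P' -> efficient (sinv r) P' P.
Proof.
move=> cP cP' [rP rP' min]; split; rewrite ?sinvK // => t tP' tP.
have tU := cluster_universe cP' tP'.
have rU := cluster_universe cP rP.
by rewrite ord_inv // -(ord_inv tU) min // sinvK.
Qed.

(** The inverse of the join lies below [sinv r], so it is in [P'] whichever way
    [P'] orients [s]. *)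
Lemma efficient_join r s P P' :
  cluster P -> cluster P' -> efficient r P P' -> s \in P ->
  ord (sjoin r s) <= ord r -> efficient (sjoin r s) P P'.
Proof.
move=> cP cP' [rP rP' min] sP le.
have rU := cluster_universe cP rP.
have sU := cluster_universe cP sP.
have jU : sjoin r s \in U by apply: sepsU.
split=> [||t tP tP'].
- exact: (cluster_join cP rP sP rP).
- apply: (cluster_down cP' rP' rP'); rewrite ?universe_sinv //.
    by rewrite !ord_inv.
  by rewrite sle_inv sle_joinl.
- by apply: le_trans le _; apply: min.
Qed.

Lemma efficient_meet r s P P' :
  cluster P -> cluster P' -> efficient r P P' -> sinv s \in P' ->
  ord (smeet r s) <= ord r -> efficient (smeet r s) P P'.
Proof.
move=> cP cP' er sP le; have rU : r \in U by case: er => /(cluster_universe cP).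
have sU : s \in U by rewrite -universe_sinv (cluster_universe cP').
have mU : smeet r s \in U by apply: sepsI.
suff : efficient (sinv (sjoin (sinv r) (sinv s))) P P'.
  by rewrite /smeet /sjoin /sinv.
apply: efficient_sinv => //; apply: efficient_join => //.
  exact: efficient_sinv.
by rewrite -[sjoin _ _]/(sinv (smeet r s)) !ord_inv.
Qed.

(** Submodularity bounds the sum of the orders of the two corners by [a + a].
    When used, the last two hypotheses hold because a corner of order at most
    [a] is a distinguisher, whose order efficiency bounds below by [a]. So
    neither corner has order less than [a], and hence neither has more. *)
Lemma tight_corners r s (a : R) :
  r \in U -> s \in U -> ord r = a -> ord s = a ->
  (ord (sjoin r s) <= a -> a <= ord (sjoin r s)) ->
  (ord (smeet r s) <= a -> a <= ord (smeet r s)) ->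
  ord (sjoin r s) <= a /\ ord (smeet r s) <= a.
Proof.
move=> rU sU ra sa hj hm; have := ord_submod rU sU; rewrite ra sa => sub.
have bd (x y : R) : x + y <= a + a -> a <= y -> x <= a.
  move=> h ay; rewrite -(lerD2r a); apply: le_trans h.
  by rewrite lerD2l.
have lej : a <= ord (sjoin r s).
  by case: (leP (ord (sjoin r s)) a) => [/hj|/ltW].
have lem : a <= ord (smeet r s).
  by case: (leP (ord (smeet r s)) a) => [/hm|/ltW].
by split; [apply: bd sub lem | rewrite addrC in sub; apply: bd sub lej].
Qed.

Lemma efficient_le r P P' t :
  efficient r P P' -> efficient t P P' -> ord r <= ord t.
Proof. by move=> [_ _ h] [tP tP' _]; apply: h. Qed.

(** * Uncrossing efficient distinguishers *)

Definition crossing_number r : nat := #|[set t in U | ~~ nest r t]|.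

Lemma crossing_number_sinv r : crossing_number (sinv r) = crossing_number r.
Proof. by apply: eq_card => t; rewrite !inE nest_sinvl. Qed.

(** Corners cross less: a separation crossing one of two opposite corners
    crosses [r] or [s], one crossing both corners crosses both [r] and [s],
    and the crossing of [r] with [s] itself disappears. *)
Lemma crossing_number_corners r s :
  r \in U -> s \in U -> ~~ nest r s ->
  (crossing_number (sjoin r s) + crossing_number (smeet r s) <
   crossing_number r + crossing_number s)%N.
Proof.
move=> rU sU crs.
have crE x : crossing_number x = (\sum_(t in U) ~~ nest x t)%N.
  rewrite /crossing_number -sum1_card big_mkcond [RHS]big_mkcond /=.
  by apply: eq_bigr => t _; rewrite inE; case: (t \in U); case: (nest x t).
rewrite !crE -!big_split /= !(bigD1 (op:=addn) r rU) /=.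
have nm : nest (smeet r s) r by rewrite /nest sle_meetl.
rewrite nest_join_self nm nest_refl (nestC s r) crs /= add0n add1n ltnS.
apply: leq_sum => t _.
have h1 := @nest_join _ r s t crs; have h2 := @nest_meet _ r s t crs.
have h3 := @nest_join_or_meet _ r s t; have h4 := @nest_join_or_meet _ s r t.
rewrite (sjoinC s) (smeetC s) in h4.
case: (nest r t) (nest s t) h1 h2 h3 h4 => [] [] h1 h2 h3 h4.
- by rewrite h1 // h2.
- by case/orP: (h3 isT) => ->; rewrite ?addn0; case: (nest _ _).
- by case/orP: (h4 isT) => ->; rewrite ?addn0; case: (nest _ _).
- by case: (nest _ _); case: (nest _ _).
Qed.

(** Having smaller order than [s], the separation [r] is oriented by [Q] and
    [Q'], and in the same way: say [r] lies in both. If [sjoin r s] or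
    [sjoin r (sinv s)] has order at most that of [s], it distinguishes [Q] from
    [Q']. Otherwise submodularity makes [smeet r s] and [smeet r (sinv s)]
    smaller in order than [r]. Both lie below the orientation of [r] in one of
    [P], [P'], hence in that cluster; as [r] is efficient, they do not
    distinguish [P] from [P'], hence lie in the other cluster too. This
    contradicts the robustness of the latter, which contains [sinv r]. *)
Lemma uncross_lower r s P P' Q Q' :
  cluster P -> cluster P' -> cluster Q -> cluster Q' ->
  efficient r P P' -> efficient s Q Q' -> ord r < ord s -> ~~ nest r s ->
  exists c, [/\ efficient c Q Q', nest c r &
    forall u, nest r u -> nest s u -> nest c u].
Proof.
wlog rQ : r P P' / r \in Q.
  move=> hw cP cP' cQ cQ' er es lt crs.
  have [rP rP' _] := er; have rU := cluster_universe cP rP.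
  have [sQ _ _] := es.
  case: (cluster_orients cQ sQ rU (ltW lt)) => rQ; first exact: (hw r P P').
  have [] := hw (sinv r) P' P rQ cP' cP cQ cQ' _ es.
  - exact: efficient_sinv.
  - by rewrite ord_inv.
  - by rewrite nest_sinvl.
  move=> c [ec cr h]; exists c; split=> // [|u ru su].
    by rewrite -nest_sinvr.
  by apply: h; rewrite ?nest_sinvl.
move=> cP cP' cQ cQ' er es lt crs.
have [rP rP' minr] := er; have [sQ sQ' mins] := es.
have rU := cluster_universe cP rP; have sU := cluster_universe cQ sQ.
have isU : sinv s \in U by rewrite universe_sinv.
(* Otherwise [r] would distinguish [Q] from [Q'] at smaller order than [s]. *)
have rQ' : r \in Q'.
  have le : ord r <= ord (sinv s) by rewrite ord_inv // ltW.
  case: (cluster_orients cQ' sQ' rU le) => // irQ'.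
  by have := mins _ rQ irQ'; rewrite leNgt lt.
have [le1|gt1] := leP (ord (sjoin s r)) (ord s).
  exists (sjoin s r); split; first exact: efficient_join.
    by rewrite sjoinC nest_join_self.
  by move=> u ru su; rewrite sjoinC nest_join.
have [le2|gt2] := leP (ord (smeet s (sinv r))) (ord s).
  exists (smeet s (sinv r)); split.
  - by apply: efficient_meet; rewrite ?sinvK.
  - by rewrite -nest_sinvr /nest sle_meetr.
  by move=> u ru su; rewrite nest_meet ?nest_sinvl ?nest_sinvr // nestC.
have lt_meet x : x \in U -> ord x = ord s -> ord s < ord (sjoin r x) ->
    ord (smeet r x) < ord r.
  move=> xU xs gt; have := ord_submod rU xU; rewrite xs => sub.
  rewrite -(ltrD2l (ord s)) [ltRHS]addrC; apply: lt_le_trans sub.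
  by rewrite ltrD2r.
have lt1 : ord (smeet r s) < ord r by apply: lt_meet; rewrite 1?sjoinC.
have lt2 : ord (smeet r (sinv s)) < ord r.
  apply: lt_meet; rewrite ?ord_inv //.
  move: gt2; have -> : smeet s (sinv r) = sinv (sjoin r (sinv s)).
    by rewrite smeetC.
  by rewrite ord_inv //; apply: sepsU.
have inP' x : x \in U -> ord (smeet r x) < ord r -> smeet r x \in P'.
  move=> xU ltx; have mU : smeet r x \in U by apply: sepsI.
  have mP : smeet r x \in P.
    by apply: (cluster_down cP rP rP mU (ltW ltx)); apply: sle_meetl.
  have le : ord (smeet r x) <= ord (sinv r) by rewrite ord_inv // ltW.
  case: (cluster_orients cP' rP' mU le) => // imP'.
  by have := minr _ mP imP'; rewrite leNgt ltx.
case: (cP') => _ rob _; case: (rob _ s rP' sU); rewrite ?ord_inv //.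
by split; apply: inP'.
Qed.

(** Two crossing distinguishers of equal order always have a pair of opposite
    corners that distinguish efficiently as well. Which pair it is, and for
    which clusters, depends on how each of the two separations is oriented by
    the clusters that the other one distinguishes. *)
Lemma uncross_same_order r s P P' Q Q' :
  cluster P -> cluster P' -> cluster Q -> cluster Q' ->
  efficient r P P' -> efficient s Q Q' -> ord r = ord s ->
  let forP c := efficient c P P' \/ efficient c P' P in
  let forQ c := efficient c Q Q' \/ efficient c Q' Q in
  exists2 s', s' = s \/ s' = sinv s &
    [\/ forP (sjoin r s') /\ forP (smeet r s'),
        forP (sjoin r s') /\ forQ (smeet r s') |
        forQ (sjoin r s') /\ forP (smeet r s')].
Proof.
wlog sP : s Q Q' / s \in P.
  move=> hw cP cP' cQ cQ' er es eo.
  have [rP _ _] := er; have [sQ _ _] := es; have sU := cluster_universe cQ sQ.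
  have le : ord s <= ord r by rewrite eo.
  case: (cluster_orients cP rP sU le) => sP; first exact: (hw s Q Q').
  have [||s' es' h] := hw (sinv s) Q' Q sP cP cP' cQ' cQ er.
  - exact: efficient_sinv.
  - by rewrite ord_inv.
  exists s'; first by case: es' => ->; rewrite ?sinvK; [right | left].
  by case: h => h; [apply: Or31 | apply: Or32 | apply: Or33]; tauto.
move=> cP cP' cQ cQ' er es eo forP forQ.
have [rP rP' _] := er; have [sQ sQ' _] := es.
have rU := cluster_universe cP rP; have sU := cluster_universe cQ sQ.
have isU : sinv s \in U by rewrite universe_sinv.
have eis := efficient_sinv cQ cQ' es.
have les : ord s <= ord (sinv r) by rewrite ord_inv // eo.
have ler : ord r <= ord (sinv s) by rewrite ord_inv // eo.
(* If [s] also distinguishes [P] from [P'], both corners do. *)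
case: (cluster_orients cP' rP' sU les) => sP'; last first.
  have hj := efficient_join cP cP' er sP.
  have hm := efficient_meet cP cP' er sP'.
  exists s; first by left.
  have [|||] := @tight_corners r s (ord r) rU sU erefl.
  - by rewrite eo.
  - by move/hj; apply: efficient_le.
  - by move/hm; apply: efficient_le.
  by move=> /hj ej /hm em; apply: Or31; split; left.
(* Otherwise [s] lies in both [P] and [P'], and the side on which [Q'] has
   [r] determines which pair of opposite corners yields one distinguisher for
   each of the two pairs of clusters. *)
case: (cluster_orients cQ' sQ' rU ler) => rQ'.
  have hm : ord (smeet r (sinv s)) <= ord r ->
      efficient (smeet r (sinv s)) P P'.
    by apply: efficient_meet => //; rewrite sinvK.
  have hj : ord (sjoin r (sinv s)) <= ord r ->
      efficient (sjoin r (sinv s)) Q' Q.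
    by rewrite sjoinC => le; apply: efficient_join; rewrite // ord_inv // -eo.
  exists (sinv s); first by right.
  have [|||] := @tight_corners r (sinv s) (ord r) rU isU erefl.
  - by rewrite ord_inv.
  - by move/hj/(efficient_le eis); rewrite ord_inv // eo.
  - by move/hm; apply: efficient_le.
  by move=> /hj ej /hm em; apply: Or33; split; [right | left].
have hj := efficient_join cP cP' er sP.
have hm : ord (smeet r s) <= ord r -> efficient (smeet r s) Q Q'.
  by rewrite smeetC eo; apply: efficient_meet.
exists s; first by left.
have [|||] := @tight_corners r s (ord r) rU sU erefl.
- by rewrite eo.
- by move/hj; apply: efficient_le.
- by move/hm/(efficient_le es); rewrite eo.
by move=> /hj ej /hm em; apply: Or32; split; left.
Qed.

(** * The construction by levels *)

Definition eligible N P P' r : Prop :=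
  efficient r P P' /\ forall t, t \in N -> nest r t.

Definition chosen N P P' r : Prop :=
  eligible N P P' r /\
  forall t, eligible N P P' t -> (crossing_number r <= crossing_number t)%N.

Lemma eligible_sinv N P P' r :
  cluster P -> cluster P' -> eligible N P P' r -> eligible N P' P (sinv r).
Proof.
move=> cP cP' [er nr]; split; first exact: efficient_sinv.
by move=> t tN; rewrite nest_sinvl nr.
Qed.

Lemma chosen_sinv N P P' r :
  cluster P -> cluster P' -> chosen N P P' r -> chosen N P' P (sinv r).
Proof.
move=> cP cP' [er min]; split; first exact: eligible_sinv.
move=> t et; rewrite crossing_number_sinv -(crossing_number_sinv t).
by apply: min; apply: eligible_sinv.
Qed.

(** If [r] and [s] crossed, two opposite corners would be eligible too, each
    for the clusters of [r] or for those of [s], and at least one of them for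
    the clusters of whichever of [r], [s] crosses more. By the minimality of
    the crossing numbers of [r] and [s], the corners would then cross in total
    at least as much as [r] and [s]. *)
Lemma chosen_nest N P P' Q Q' r s :
  cluster P -> cluster P' -> cluster Q -> cluster Q' ->
  chosen N P P' r -> chosen N Q Q' s -> ord r = ord s -> nest r s.
Proof.
wlog le : P P' Q Q' r s / (crossing_number s <= crossing_number r)%N.
  move=> hw cP cP' cQ cQ' hr hs eo.
  case/orP: (leq_total (crossing_number s) (crossing_number r)) => le.
    exact: (hw P P' Q Q').
  by rewrite nestC; apply: (hw Q Q' P P').
move=> cP cP' cQ cQ' [[er nr] minr] [[es ns] mins] eo.
apply: contraT => crs.
have rU : r \in U by case: er => /(cluster_universe cP).
have sU : s \in U by case: es => /(cluster_universe cQ).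
have [s' es' h] := uncross_same_order cP cP' cQ cQ' er es eo.
have s'U : s' \in U by case: es' => ->; rewrite ?universe_sinv.
have crs' : ~~ nest r s' by case: es' => ->; rewrite ?nest_sinvr.
have ns' t : t \in N -> nest s' t.
  by case: es' => -> tN; rewrite ?nest_sinvl; apply: ns.
have crE : crossing_number s' = crossing_number s.
  by case: es' => ->; rewrite ?crossing_number_sinv.
have nj t : t \in N -> nest (sjoin r s') t.
  by move=> tN; apply: nest_join; auto.
have nm t : t \in N -> nest (smeet r s') t.
  by move=> tN; apply: nest_meet; auto.
have geP c : (forall t, t \in N -> nest c t) ->
    efficient c P P' \/ efficient c P' P ->
    (crossing_number r <= crossing_number c)%N.
  move=> nc [ec|ec]; first exact: minr.
  by rewrite -(crossing_number_sinv c); apply: minr; apply: eligible_sinv.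
have geQ c : (forall t, t \in N -> nest c t) ->
    efficient c Q Q' \/ efficient c Q' Q ->
    (crossing_number s <= crossing_number c)%N.
  move=> nc [ec|ec]; first exact: mins.
  by rewrite -(crossing_number_sinv c); apply: mins; apply: eligible_sinv.
have := crossing_number_corners rU s'U crs'; rewrite crE ltnNge => /negP[].
case: h => [[hj hm]|[hj hm]|[hj hm]].
- by apply: leq_add; [apply: geP | apply: leq_trans le _; apply: geP].
- by apply: leq_add; [apply: geP | apply: geQ].
- by rewrite addnC; apply: leq_add; [apply: geQ | apply: geP].
Qed.

Lemma chosen_exists N P P' r :
  eligible N P P' r -> exists t, chosen N P P' t.
Proof.
move=> /asboolP er.
case: (arg_minnP (P := fun t => `[< eligible N P P' t >]) crossing_number er).
move=> t /asboolP et min; exists t; split=> // u eu.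
by apply: min; apply/asboolP.
Qed.

(** Among the efficient distinguishers, one that crosses as few elements of
    [N] as possible crosses none: uncrossing it from an element of [N]
    destroys no nestedness with the other elements, as [N] is nested. *)
Lemma eligible_exists N Q Q' s :
  cluster Q -> cluster Q' -> efficient s Q Q' ->
  {in N &, forall r t, nest r t} ->
  (forall r, r \in N -> ord r < ord s /\
    exists P P', [/\ cluster P, cluster P' & efficient r P P']) ->
  exists t, eligible N Q Q' t.
Proof.
move=> cQ cQ' /asboolP es nN hN.
pose conflicts x := #|[set t in N | ~~ nest x t]|.
case: (arg_minnP (P := fun t => `[< efficient t Q Q' >]) conflicts es).
move=> t /asboolP et min; exists t; split=> // r rN.
apply: contraT => crs.
have [lt [P [P' [cP cP' er]]]] := hN _ rN.
have lt' : ord r < ord t.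
  by apply: lt_le_trans lt _; move/asboolP: es => es; apply: efficient_le et.
rewrite nestC in crs.
have [c [ec cr nc]] := uncross_lower cP cP' cQ cQ' er et lt' crs.
move/asboolP/min: ec; rewrite leqNgt => /negP[].
apply: proper_card; apply/properP; split.
  apply/subsetP=> u; rewrite !inE => /andP[uN]; rewrite uN /=.
  by apply: contra => tu; apply: nc => //; apply: nN.
by exists r; rewrite !inE rN ?cr // nestC.
Qed.

(** Ranks replace the real values of the order function by natural numbers
    that can be recursed on. *)
Definition rank r : nat := #|[set t in U | ord t < ord r]|.

Lemma rank_lt r s : r \in U -> ord r < ord s -> (rank r < rank s)%N.
Proof.
move=> rU lt; apply: proper_card; apply/properP; split.
  by apply/subsetP=> t; rewrite !inE => /andP[-> /lt_trans->].
by exists r; rewrite inE rU ?lt ?ltxx.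
Qed.

Lemma rank_ord r s : ord r = ord s -> rank r = rank s.
Proof. by rewrite /rank => ->. Qed.

Lemma ord_lt_rank r s : s \in U -> (rank r < rank s)%N -> ord r < ord s.
Proof.
move=> sU lt; rewrite ltNge; apply: contraTN lt.
rewrite le_eqVlt -leqNgt => /orP[/eqP/rank_ord->//|/(rank_lt sU)/ltnW//].
Qed.

Lemma ord_rank r s : r \in U -> s \in U -> rank r = rank s -> ord r = ord s.
Proof.
move=> rU sU e; case: (ltgtP (ord r) (ord s)) => // /rank_lt.
  by move/(_ rU); rewrite e ltnn.
by move/(_ sU); rewrite e ltnn.
Qed.

Lemma rank_bound r : r \in U -> (rank r < #|U|)%N.
Proof.
move=> rU; apply: proper_card; apply/properP; split.
  by apply/subsetP=> t; rewrite inE => /andP[].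
by exists r; rewrite // inE ltxx andbF.
Qed.

(** [N] stands for the separations selected at levels below [n]. All pairs of
    clusters with the same level select simultaneously, and each selects all
    of its optimal candidates. *)
Definition select N n : {set osep S} :=
  [set r | (rank r == n) &&
    `[< exists P P', [/\ cluster P, cluster P' & chosen N P P' r] >]].

Fixpoint tree n : {set osep S} :=
  if n is m.+1 then tree m :|: select (tree m) m else set0.

Lemma treeS n r :
  r \in tree n.+1 <->
  r \in tree n \/ rank r = n /\
    exists P P', [/\ cluster P, cluster P' & chosen (tree n) P P' r].
Proof.
rewrite /= !inE; split.
  by case/orP=> [|/andP[/eqP ? /asboolP]]; [left | right].
by case=> [->//|[/eqP-> h]]; apply/orP; right; apply/asboolP.
Qed.

Lemma tree_efficient n r :
  r \in tree n -> (rank r < n)%N /\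
    exists P P', [/\ cluster P, cluster P' & efficient r P P'].
Proof.
elim: n => [|n IH]; first by rewrite inE.
case/treeS => [/IH[lt h]|[-> [P [P' [cP cP' [[er _] _]]]]]].
  by split=> //; apply: ltnW.
by split=> //; exists P, P'.
Qed.

Lemma tree_universe n : {subset tree n <= U}.
Proof.
move=> r /tree_efficient[_ [P [P' [cP _ [rP _ _]]]]].
exact: (cluster_universe cP).
Qed.

Lemma tree_sinv n r : r \in tree n -> sinv r \in tree n.
Proof.
elim: n => [|n IH]; first by rewrite inE.
move=> rT; have rU := tree_universe rT; apply/treeS.
case/treeS: rT => [/IH|[rr [P [P' [cP cP' ch]]]]]; [by left | right].
split; first by rewrite -rr; apply/rank_ord/ord_inv.
by exists P', P; split=> //; apply: chosen_sinv.
Qed.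

Lemma tree_nest n : {in tree n &, forall r s, nest r s}.
Proof.
elim: n => [|n IH] r s; first by rewrite inE.
move=> rT sT; have rU := tree_universe rT; have sU := tree_universe sT.
case/treeS: rT => [rT|[rr [P [P' [cP cP' chr]]]]].
  case/treeS: sT => [|[_ [Q [Q' [_ _ [[_ ns] _]]]]]]; first exact: IH.
  by rewrite nestC ns.
case/treeS: sT => [sT|[rs [Q [Q' [cQ cQ' chs]]]]].
  by case: chr => [[_ nr] _]; apply: nr.
apply: chosen_nest cP cP' cQ cQ' chr chs _.
by apply: ord_rank; rewrite // rr.
Qed.

Lemma tree_complete n r P P' :
  cluster P -> cluster P' -> efficient r P P' -> (rank r < n)%N ->
  exists2 t, t \in tree n & efficient t P P'.
Proof.
move=> cP cP' er; have rU : r \in U by case: er => /(cluster_universe cP).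
elim: n => [//|n IH]; rewrite ltnS leq_eqVlt => /orP[/eqP rn|/IH[t tT et]].
  have [t0 et0] : exists t, eligible (tree n) P P' t.
    apply: eligible_exists cP cP' er (@tree_nest n) _.
    move=> t /tree_efficient[lt h]; split=> //.
    by apply: ord_lt_rank; rewrite ?rn.
  have [t ct] := chosen_exists et0; have [[et _] _] := ct.
  exists t => //; apply/treeS; right; split; last by exists P, P'.
  rewrite -rn; apply/rank_ord/eqP.
  by rewrite eq_le (efficient_le et er) (efficient_le er et).
by exists t => //; apply/treeS; left.
Qed.

End Construction.

(** * Invariance under isomorphisms *)

Section Isomorphism.
Variables (R : realType) (S S' : submodular_data R) (f : osep S -> osep S').
Hypothesis iso : universe_iso f.
Implicit Types (r s t : osep S) (P N : {set osep S}).
Local Notation U := (universe S).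
Local Notation U' := (universe S').

Let f_inj : {in U &, injective f}. Proof. by case: iso. Qed.
Let f_im : f @: U = U'. Proof. by case: iso. Qed.
Let f_sle : {in U &, forall r s, sle (f r) (f s) = sle r s}.
Proof. by case: iso. Qed.
Let f_sinv : {in U, forall s, f (sinv s) = sinv (f s)}.
Proof. by case: iso. Qed.
Let f_ord : {in U, forall s, ord (f s) = ord s}. Proof. by case: iso. Qed.

Lemma iso_universe r : r \in U -> f r \in U'.
Proof. by move=> rU; rewrite -f_im imset_f. Qed.

Lemma iso_onto y : y \in U' -> exists2 r, r \in U & y = f r.
Proof. by rewrite -f_im => /imsetP. Qed.

Lemma iso_mem P r : {subset P <= U} -> r \in U -> (f r \in f @: P) = (r \in P).
Proof.
move=> PU rU; apply/imsetP/idP => [[x xP /f_inj->//]|rP]; first exact: PU.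
by exists r.
Qed.

(** An isomorphism respects joins because [sjoin r s] is the supremum of [r]
    and [s] within the universe, which is closed under joins. *)
Lemma iso_join r s : r \in U -> s \in U -> f (sjoin r s) = sjoin (f r) (f s).
Proof.
move=> rU sU; have jU : sjoin r s \in U by apply: sepsU.
have [|z zU ez] := @iso_onto (sjoin (f r) (f s)).
  by apply: sepsU; apply: iso_universe.
apply: sle_anti.
  rewrite ez f_sle //; apply: sjoin_le.
    by rewrite -f_sle // -ez sle_joinl.
  by rewrite -f_sle // -ez sle_joinr.
by apply: sjoin_le; rewrite f_sle // ?sle_joinl ?sle_joinr.
Qed.

Lemma iso_meet r s : r \in U -> s \in U -> f (smeet r s) = smeet (f r) (f s).
Proof.
move=> rU sU.
have -> : smeet r s = sinv (sjoin (sinv r) (sinv s)) by [].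
rewrite f_sinv ?iso_join ?universe_sinv //; last first.
  by apply: sepsU; rewrite -/(universe S) universe_sinv.
by rewrite !f_sinv.
Qed.

Lemma iso_nest r s : r \in U -> s \in U -> nest (f r) (f s) = nest r s.
Proof.
by move=> rU sU; rewrite /nest -!f_sinv // !f_sle ?universe_sinv.
Qed.

Lemma iso_small r : r \in U -> small (f r) = small r.
Proof. by move=> rU; rewrite /small -f_sinv // f_sle ?universe_sinv. Qed.

Lemma iso_degenerate r : r \in U -> degenerate (f r) = degenerate r.
Proof.
move=> rU; rewrite /degenerate -f_sinv //.
by rewrite (inj_in_eq f_inj) ?universe_sinv.
Qed.

Lemma iso_slt r s : r \in U -> s \in U -> slt (f r) (f s) = slt r s.
Proof. by move=> rU sU; rewrite /slt f_sle // (inj_in_eq f_inj). Qed.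

Lemma iso_oS k r : r \in U -> (f r \in oS S' k) = (r \in oS S k).
Proof.
by move=> rU; rewrite in_set [in RHS]in_set iso_universe // rU f_ord.
Qed.

Lemma iso_cluster P : cluster P -> cluster (f @: P).
Proof.
move=> cP; have PU := cluster_universe cP.
have oSU (T : submodular_data R) k (x : osep T) :
    x \in oS T k -> x \in universe T.
  by rewrite in_set => /andP[].
case: cP => [[k k0 [[sub or] con pr]] rob reg]; split.
- exists k => //; split.
  + split.
      apply/subsetP=> _ /imsetP[x xP ->].
      by rewrite iso_oS ?PU // (subsetP sub).
    move=> r' r'o; have [r rU er] := iso_onto (oSU _ _ _ r'o); subst r'.
    rewrite iso_degenerate // -f_sinv // !iso_mem ?universe_sinv //.
    by apply: or; rewrite -iso_oS.
  + case=> r' [s' [[r'o s'o ne] [lt r'P s'P]]]; apply: con.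
    have [r rU er] := iso_onto (oSU _ _ _ r'o).
    have [s sU es] := iso_onto (oSU _ _ _ s'o); subst r' s'.
    exists r, s; split; split.
    * by rewrite -iso_oS.
    * by rewrite -iso_oS.
    * apply: contraNneq ne => /unorient_eq[->//|->].
      by rewrite f_sinv // unorient_sinv.
    * by rewrite -iso_slt.
    * by rewrite -iso_mem ?universe_sinv // f_sinv.
    * by rewrite -iso_mem.
  + move=> _ _ /imsetP[r rP ->] /imsetP[s sP ->].
    have jU : sjoin r s \in U by apply: sepsU; apply: PU.
    by rewrite -iso_join ?PU // -f_sinv // iso_mem ?universe_sinv ?pr.
- move=> _ s' /imsetP[r rP ->] /iso_onto[s sU ->].
  have rU := PU _ rP.
  have mU x : x \in U -> smeet (sinv r) x \in U.
    by move=> xU; apply: sepsI => //; rewrite -/(universe S) universe_sinv.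
  rewrite -!f_sinv // -!iso_meet ?universe_sinv //.
  have isU : sinv s \in U by rewrite universe_sinv.
  rewrite !iso_mem ?mU // !f_ord ?mU //.
  exact: rob.
- move=> _ /imsetP[r rP ->]; have rU := PU _ rP.
  by rewrite -f_sinv // iso_small ?universe_sinv // reg.
Qed.

Lemma iso_eligible N P P' r :
  {subset N <= U} -> {subset P <= U} -> {subset P' <= U} -> r \in U ->
  eligible (f @: N) (f @: P) (f @: P') (f r) <-> eligible N P P' r.
Proof.
move=> NU PU P'U rU.
split=> [[[rP rP' min] n]|[[rP rP' min] n]]; split.
- rewrite iso_mem // in rP; rewrite -f_sinv // iso_mem ?universe_sinv // in rP'.
  split=> // t tP tP'; have tU := PU _ tP.
  rewrite -!f_ord //; apply: min; first by rewrite iso_mem.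
  by rewrite -f_sinv // iso_mem ?universe_sinv.
- move=> t tN; have tU := NU _ tN.
  by rewrite -iso_nest // n // iso_mem.
- split; [by rewrite iso_mem | by rewrite -f_sinv // iso_mem ?universe_sinv |].
  move=> _ /imsetP[t tP ->]; have tU := PU _ tP.
  rewrite -f_sinv // iso_mem ?universe_sinv // => tP'.
  by rewrite !f_ord //; apply: min.
- move=> _ /imsetP[t tN ->]; have tU := NU _ tN.
  by rewrite iso_nest // n.
Qed.

Lemma iso_card (A : pred (osep S)) (A' : pred (osep S')) :
  {in U, forall r, A' (f r) = A r} ->
  #|[set y in U' | A' y]| = #|[set x in U | A x]|.
Proof.
move=> e; rewrite -(card_in_imset (f := f)); last first.
  by move=> x y /setIdP[xU _] /setIdP[yU _]; apply: f_inj.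
apply: eq_card => y; apply/setIdP/imsetP.
  case=> /iso_onto[x xU ->] Ax; exists x => //.
  by apply/setIdP; rewrite -e.
case=> x /setIdP[xU Ax] ->.
by rewrite iso_universe ?e.
Qed.

Lemma iso_crossing_number r :
  r \in U -> crossing_number (f r) = crossing_number r.
Proof.
by move=> rU; apply: iso_card => t tU; rewrite iso_nest.
Qed.

Lemma iso_rank r : r \in U -> rank (f r) = rank r.
Proof.
by move=> rU; apply: iso_card => t tU; rewrite !f_ord.
Qed.

Lemma iso_select N n r :
  {subset N <= U} -> r \in select N n -> f r \in select (f @: N) n.
Proof.
move=> NU; rewrite !inE => /andP[rr /asboolP[P [P' [cP cP' [er min]]]]].
have PU := cluster_universe cP; have P'U := cluster_universe cP'.
have rU : r \in U by case: er => [[/PU]].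
rewrite iso_rank // rr; apply/asboolP.
exists (f @: P), (f @: P'); split; try exact: iso_cluster.
split; first by apply/iso_eligible.
move=> t' et'; have [[/imsetP[t tP e] _ _] _] := et'; subst t'.
have tU := PU _ tP; rewrite !iso_crossing_number //.
by apply: min; apply/(iso_eligible NU PU P'U).
Qed.

(** Having the inverse as an isomorphism makes it enough to prove that
    isomorphisms map selected separations to selected ones. *)
Lemma iso_inverse : exists g : osep S' -> osep S,
  [/\ universe_iso g, {in U, cancel f g} & {in U', cancel g f}].
Proof.
pose g y := odflt (set0, set0) [pick x in U | f x == y].
have fK : {in U, cancel f g}.
  move=> x xU; rewrite /g; case: pickP => [z /andP[zU /eqP/f_inj]|/(_ x)].
    by apply.
  by rewrite xU eqxx.
have gK : {in U', cancel g f} by move=> _ /iso_onto[x xU ->]; rewrite fK.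
have gU y : y \in U' -> g y \in U by move=> /iso_onto[x xU ->]; rewrite fK.
exists g; split=> //; split.
- exact: can_in_inj gK.
- apply/setP=> x; apply/imsetP/idP=> [[y yU ->]|xU]; first exact: gU.
  by exists (f x); rewrite ?iso_universe ?fK.
- by move=> y z yU zU; rewrite -f_sle ?gU // !gK.
- move=> _ /iso_onto[x xU ->].
  by rewrite -f_sinv // !fK ?universe_sinv.
- by move=> y yU; rewrite -f_ord ?gU // gK.
Qed.

End Isomorphism.

Lemma iso_tree (R : realType) (S S' : submodular_data R)
    (f : osep S -> osep S') n :
  universe_iso f -> f @: tree S n = tree S' n.
Proof.
move=> iso; have [g [iso' fK gK]] := iso_inverse iso.
elim: n => [|n IH]; first exact: imset0.
rewrite /= imsetU IH; congr (_ :|: _).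
have IH' : g @: tree S' n = tree S n.
  rewrite -IH -imset_comp -[RHS]imset_id; apply: eq_in_imset => x.
  by move=> /tree_universe; apply: fK.
apply/setP=> y; apply/imsetP/idP => [[x xs ->]|ys].
  by rewrite -IH; apply: iso_select xs => //; apply: tree_universe.
have yU : y \in universe S'.
  have : y \in tree S' n.+1 by rewrite /= inE ys orbT.
  exact: tree_universe.
exists (g y); last by rewrite gK.
by rewrite -IH'; apply: iso_select ys => //; apply: tree_universe.
Qed.

(** * The canonical tree set *)

(** Ranks are smaller than the size of the universe, so by that number of steps
    all levels have been treated; being an invariant, it stops isomorphic
    universes at the same step. *)
Definition canonical_tree (R : realType) (S : submodular_data R) :
    {set sep S} :=
  @unorient S @: tree S #|universe S|.

Lemma orientations_canonical_tree (R : realType) (S : submodular_data R) :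
  orientations (canonical_tree S) = tree S #|universe S|.
Proof.
apply/setP=> r; rewrite inE; apply/imsetP/idP => [[t tT]|rT]; last by exists r.
by case/unorient_eq => ->; rewrite ?tree_sinv.
Qed.

Lemma canonical_tree_regular (R : realType) (S : submodular_data R) :
  regular_seps (canonical_tree S).
Proof.
move=> r; rewrite orientations_canonical_tree => rT.
have [_ [P [P' [_ cP' [_ rP' _]]]]] := tree_efficient rT.
by have := cluster_not_small cP' rP'; rewrite sinvK.
Qed.

Theorem theorem5 (R : realType) :
  exists T : forall S : submodular_data R, {set sep S},
    (forall S : submodular_data R,
      [/\ T S \subset seps S,
          tree_set (T S),
          regular_seps (T S) &
          efficiently_distinguishes_clusters (T S)]) /\
    canonical T.
Proof.
exists (@canonical_tree R); split=> [S|S S' f iso]; last first.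
  rewrite !orientations_canonical_tree (iso_tree _ iso).
  by case: (iso) => inj <- _ _ _; rewrite card_in_imset.
have reg := @canonical_tree_regular R S.
split=> //.
- apply/subsetP=> _ /imsetP[r /tree_universe rU ->].
  by rewrite inE in rU.
- split=> [_ _ /imsetP[r rT ->] /imsetP[s sT ->]|r rT].
    case/nestP: (tree_nest rT sT) => [[]|[]] h.
    + by exists r, s; split=> //; right.
    + by exists r, (sinv s); rewrite unorient_sinv; split=> //; right.
    + by exists r, s; split=> //; left.
    + by exists r, (sinv s); rewrite unorient_sinv; split=> //; left.
  (* From [r <= s] and [r <= sinv s], that is [s <= sinv r], a trivial [r] is
     small. *)
  split=> [[s [_ /andP[_ rs] /andP[_ rs']]]|].
    case/negP: (reg r rT); apply: sle_trans rs _.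
    by rewrite sle_invr.
  by apply: contra (reg r rT) => /eqP e; rewrite /small -e sle_refl.
move=> P P' cP cP' [_ [_ [r0 [_ _ r0P r0P']]]].
pose splits x := (x \in P) && (sinv x \in P').
have d0 : splits r0 by rewrite /splits r0P.
have [r /andP[rP rP'] min] := arg_minP (@ord R S) d0.
have rU := cluster_universe cP rP.
have er : efficient r P P'.
  by split=> // t tP tP'; apply: min; rewrite /splits tP.
have [t tT et] := tree_complete cP cP' er (rank_bound rU).
have [tP tP' mint] := et; have tU := cluster_universe cP tP.
exists (unorient t); first exact: imset_f.
split.
  split; first by rewrite inE in tU.
  exists t; split=> //.
  apply: contra (cluster_not_small cP tP) => /eqP e.
  by rewrite /small -!e sle_refl.
move=> _ [_ [u [<- _ uP uP']]] s' t' es' et'.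
have uU := cluster_universe cP uP.
have -> : ord s' = ord t by case: (unorient_eq es') => ->; rewrite ?ord_inv.
have -> : ord t' = ord u by case: (unorient_eq et') => ->; rewrite ?ord_inv.
exact: mint.
Qed.
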